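(* Let $n\ge 3$ be an integer, $0<m<\frac{n-2}{n}$, $\eta>0$, and let $\alpha,\beta\in\mathbb{R}$ satisfy $\alpha=\frac{2\beta}{1-m}>0$. Let $v$ be the radially symmetric solution of $$\frac{n-1}{m}\Delta v^m+\alpha v+\beta x\cdot\nabla v=0,\quad v>0,\quad\text{in }\mathbb{R}^n,\qquad v(0)=\eta.$$ Then $$\lim_{|x|\to\infty}\frac{|x|^2v(x)^{1-m}}{\log|x|}=\frac{2(n-1)(n-2-nm)}{\beta(1-m)}.$$
   Context: Solutions are classical positive solutions on $\mathbb{R}^n$; radially symmetric means $v(x)$ depends only on $|x|$. Under the stated hypotheses the radially symmetric solution exists and is unique. *)

(* Defs.v *)
From HB Require Import structures.
From mathcomp Require Import all_boot all_order all_algebra.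
From mathcomp Require Import all_classical all_reals all_analysis.

Set Implicit Arguments.
Unset Strict Implicit.
Unset Printing Implicit Defensive.

Import Order.TTheory GRing.Theory Num.Theory.
Import numFieldNormedType.Exports.

Local Open Scope classical_set_scope.
Local Open Scope ring_scope.

Section EuclideanSpace.
Context {R : realType} {n : nat}.
Implicit Types (f : 'rV[R]_n -> R) (x : 'rV[R]_n) (i : 'I_n).

(* The library norm `|x| on 'rV[R]_n is the sup norm; only the topology, which
   is the usual one, is taken from it. *)
Definition enorm x : R := Num.sqrt (\sum_(i < n) x 0 i ^+ 2).

(* The filter of |x| tending to infinity. *)
Definition enorm_pinfty : set_system 'rV[R]_n :=
  filter_from [set: R] (fun M => [set x | M < enorm x]).

Definition partial i f : 'rV[R]_n -> R := fun x => 'D_(delta_mx 0 i) f x.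

Definition laplacian f x : R := \sum_(i < n) partial i (partial i f) x.

(* The radial derivative x . grad f(x). *)
Definition dot_grad x f : R := \sum_(i < n) x 0 i * partial i f x.

Definition class_C1 f : Prop :=
  forall i, (forall x, derivable f x (delta_mx 0 i)) /\ continuous (partial i f).

Definition class_C2 f : Prop :=
  class_C1 f /\ forall i, class_C1 (partial i f).

Definition radially_symmetric f : Prop :=
  forall x y, enorm x = enorm y -> f x = f y.

(* [partial] is total, so the equation has its classical meaning only together
   with the C^2 requirement; since v > 0, v ^ m is then C^2 as well. *)
Definition classical_positive_solution (m alpha beta : R) (v : 'rV[R]_n -> R) :
    Prop :=
  [/\ class_C2 v,
      forall x, 0 < v x
    & forall x,
        (n%:R - 1) / m * laplacian (fun y => v y `^ m) x
        + alpha * v x + beta * dot_grad x v = 0].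

#[global] Instance enorm_pinfty_filter : Filter enorm_pinfty.
Proof.
apply: filter_from_filter; first by exists 0.
move=> a b _ _; exists (Num.max a b) => // x /=.
by rewrite gt_max => /andP[].
Qed.

End EuclideanSpace.

Arguments enorm_pinfty R n : clear implicits.

(* Main.v *)
Require Import Defs.
From HB Require Import structures.
From mathcomp Require Import all_boot all_order all_algebra.
From mathcomp Require Import all_classical all_reals all_analysis.
From mathcomp Require Import ring lra.
Import Order.TTheory GRing.Theory Num.Theory.
Import numFieldNormedType.Exports.
Local Open Scope classical_set_scope.
Local Open Scope ring_scope.

(** Write v(x) = phi(|x|), put w(r) = r^2 phi(r)^(1-m), let D = r d/dr be the
derivative in the variable log r, and let
    g = D w / w = 2 + (1-m) r phi'(r) / phi(r)
be the logarithmic slope of w. The condition alpha = 2 beta / (1-m) makes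
alpha v + beta x . grad v proportional to v g, so that the radial equation
becomes an autonomous planar system (lemma [phase_system]):
    D w = w g,     D g = (2 - g) (d - q (2 - g)) - k w g,
with d = n - 2, q = m / (1-m), k = beta / (n-1), and 2 q < d because
m < (n-2)/n. Smoothness of v at the origin gives g -> 2 as r -> 0.

The rest concerns this system (lemma [slope_limit]).
- The lines g = 0 and g = 3 are crossed only inwards, so 0 < g < 3 for all r
  (lemma [slope_bounds]) and w increases.
- w is unbounded: if w stayed below M, then for small c the line g = c would be
  crossed only upwards, g > c would persist, and w would grow at least like
  log r.
- Once w -> oo, the damping - k w g dominates: factoring w out, D g has the
  form w (psi - k g) with psi -> 0, whence g -> 0. Next z = w g = D w satisfies
    D z = w ((2 - g) (d - q (2 - g)) + g^2 - k z),
  whence z -> 2 (d - 2 q) / k. Both are instances of lemma [relax]: a quantity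
  pulled at a rate tending to infinity towards a convergent target converges.
- Finally D w -> L means that w / log r -> L, and L = 2 (d - 2 q) / k is the
  announced constant.

The Laplacian of a radial function is reduced to one variable (lemma
[laplacian_radial]) without a multivariate chain rule: at r e_0 the second
derivative in a direction e_i orthogonal to e_0 only involves
t |-> F(sqrt(t^2 + r^2)). *)

Set Implicit Arguments.
Unset Strict Implicit.

(** * Differential inequalities in the variable log r *)

Lemma is_derive_continuous (R : realType) (f : R -> R) (x df : R) :
  is_derive x 1 f df -> {for x, continuous f}.
Proof. by move=> [h _]; exact/differentiable_continuous/derivable1_diffP. Qed.

Lemma is_derive_gt0_left (R : realType) (f : R -> R) (x df : R) :
  is_derive x 1 f df -> 0 < df -> \forall y \near x^'-, f y < f x.
Proof.
move=> [fx <-] df0.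
have h : \forall h \near 0^', 0 < h^-1 *: (f (h *: 1 + x) - f x).
  have /(_ _ _ df0) := cvgr_gt _ fx.
  exact.
have h' : \forall y \near x, y - x != 0 ->
    0 < (y - x)^-1 *: (f ((y - x) *: 1 + x) - f x).
  have h1 : \forall h \near (0 : R), h != 0 -> 0 < h^-1 *: (f (h *: 1 + x) - f x).
    exact: h.
  by rewrite (near_shift x) in h1; move: h1; rewrite sub0r.
rewrite near_withinE; apply: filterS h' => y h'' yx.
have := h'' (ltr0_neq0 _); rewrite subr_lt0 => /(_ yx).
have -> : ((y - x) *: 1 + x : R) = y by rewrite /GRing.scale /= mulr1 subrK.
by rewrite /GRing.scale /= nmulr_rgt0 ?invr_lt0 subr_lt0.
Qed.

(** A trajectory that starts above the level c, and whose derivative is positive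
whenever it meets that level, stays above it: at the first point where f <= c,
f would have to reach c from above with a positive derivative. *)
Lemma barrier (R : realType) (f df : R -> R) (a c : R) :
  (forall x, a <= x -> is_derive x 1 f (df x)) -> c < f a ->
  (forall x, a <= x -> f x = c -> 0 < df x) ->
  forall x, a <= x -> c < f x.
Proof.
move=> fd fa up t at_; rewrite ltNge; apply/negP => ft.
pose S := [set s | a <= s /\ f s <= c].
have lbS : lbound S a by move=> s [].
have hS : has_inf S by split; [exists t | exists a].
(* The first point at which f <= c. *)
pose i := inf S.
have ai : a <= i by apply: lb_le_inf => //; case: hS.
have ltS s : a <= s -> s < i -> c < f s.
  move=> as_ si; rewrite ltNge; apply/negP => fs.
  by move: si; rewrite ltNge => /negP; apply; apply: ge_inf; [case: hS | split].
have ci := is_derive_continuous (fd _ ai).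
have fi : f i <= c.
  rewrite leNgt; apply/negP => cfi.
  have : \forall y \near i, c < f y by exact: (cvgr_gt _ ci).
  move=> /nbhs_ballP[e /= e0 he].
  have [s [as_ fs] si] := inf_adherent e0 hS.
  have is_ : i <= s by apply: ge_inf; [case: hS | split].
  have := he s; rewrite /ball /= ltr_distlC => /(_ _).
  by rewrite si (lt_le_trans _ is_) ?ltrBlDr ?ltrDl // ltNge fs => /(_ isT).
have ai' : a < i.
  by rewrite lt_neqAle ai andbT; apply/eqP => e; move: fi; rewrite -e leNgt fa.
have : \forall y \near i^'-, f y <= c.
  move: fi; rewrite le_eqVlt => /orP[/eqP fi|fi].
    rewrite -fi; apply: filterS (is_derive_gt0_left (fd _ ai) (up _ ai fi)).
    by move=> y /ltW.
  by apply: cvg_within; apply: filterS (cvgr_lt _ ci _ fi) => y /ltW.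
move=> h.
have : \forall y \near i^'-, False.
  near=> y.
  have : c < f y.
    apply: ltS; first by apply: ltW; near: y; exact: nbhs_left_gt.
    by near: y; exact: nbhs_left_lt.
  rewrite ltNge => /negP; apply; near: y; exact: h.
by move=> /filter_ex[].
Unshelve. all: by end_near. Qed.

(** The hypothesis says that the derivative of f with respect to log x is at
least c, so this is the mean value inequality in the variable log x. *)
Lemma ln_growth (R : realType) (f df : R -> R) (a c : R) : 0 < a ->
  (forall x, a <= x -> is_derive x 1 f (df x)) ->
  (forall x, a <= x -> c <= x * df x) ->
  forall x, a <= x -> f a + c * (ln x - ln a) <= f x.
Proof.
move=> a0 fd cd x ax.
have gt0 y : a <= y -> 0 < y by move=> ay; rewrite (lt_le_trans a0 ay).
pose g := fun y : R => f y - c * ln y.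
have gd y : a <= y -> is_derive y 1 g (df y - c / y).
  move=> ay; have := is_derive1_ln (gt0 _ ay); have := fd _ ay => ? ?.
  exact: is_deriveB.
have [||z zax] := @MVT_segment _ g (fun y => df y - c / y) _ _ ax.
- by move=> y yax; apply: gd; rewrite ltW // (itvP yax).
- apply: continuous_in_subspaceT => y; rewrite inE /= in_itv /= => /andP[ay _].
  exact: is_derive_continuous (gd _ ay).
have az : a <= z by rewrite (itvP zax).
move=> e; have : 0 <= g x - g a.
  rewrite e mulr_ge0 ?subr_ge0 // ler_pdivrMr ?gt0 // mulrC; exact: cd.
by rewrite /g; lra.
Qed.

Lemma ln_growth_unbounded (R : realType) (f df : R -> R) (a c M : R) : 0 < a ->
  0 < c ->
  (forall x, a <= x -> is_derive x 1 f (df x)) ->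
  (forall x, a <= x -> c <= x * df x) ->
  exists2 x, a <= x & M < f x.
Proof.
move=> a0 c0 fd cd.
(* The point where the lower bound f a + c (ln x - ln a) exceeds M. *)
pose x := a * expR (Num.max 0 ((M - f a) / c) + 1).
have ax : a <= x.
  by rewrite /x ler_peMr ?ltW // expR_gt1 ltr_wpDl // le_max lexx.
exists x => //; apply: lt_le_trans (ln_growth a0 fd cd ax).
rewrite /x lnM ?posrE ?expR_gt0 // expRK addrAC subrr add0r.
rewrite -ltrBlDl -ltr_pdivrMl // mulrC.
by rewrite ltr_pwDr // le_max lexx orbT.
Qed.

(** While y >= l / k + e, the right-hand side is at most - k e / 2 as soon as
lam >= 1 and psi is within k e / 2 of l; hence y decreases at least
logarithmically and has to get below l / k + e, and the barrier principle
prevents it from coming back. *)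
Lemma relax_le (R : realType) (y dy lam psi : R -> R) (k l e : R) :
  0 < k -> 0 < e ->
  (forall x : R, 0 < x -> is_derive x 1 y (dy x)) ->
  (forall x : R, 0 < x -> x * dy x = lam x * (psi x - k * y x)) ->
  lam x @[x --> +oo] --> +oo -> psi x @[x --> +oo] --> l ->
  \forall x \near +oo, y x < l / k + e.
Proof.
move=> k0 e0 yd ydE laminf psil.
pose c := l / k + e.
have hpsi : \forall x \near +oo, psi x < l + k * e / 2.
  by apply: (cvgr_lt _ psil); rewrite ltrDl divr_gt0 ?mulr_gt0.
have hlam : \forall x \near +oo, 1 <= lam x by exact: (cvgryPge _).1 laminf 1.
have [a [_ ha]] : \forall x \near +oo, [/\ 0 < x, psi x < l + k * e / 2 & 1 <= lam x].
  by near=> x; split; near: x => //; apply: nbhs_pinfty_gt; rewrite num_real.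
pose b := a + 1.
have {}ha x : b <= x -> [/\ 0 < x, psi x < l + k * e / 2 & 1 <= lam x].
  by move=> bx; apply: ha => /=; apply: lt_le_trans bx; rewrite ltrDl.
have step x : b <= x -> c <= y x -> x * dy x <= - (k * e / 2).
  move=> bx cy; have [x0 px lx] := ha _ bx; rewrite ydE //.
  have : k * c <= k * y x by rewrite ler_pM2l.
  have -> : k * c = l + k * e by rewrite /c; field; rewrite gt_eqF.
  move=> kc.
  have ke : 0 < k * e by rewrite mulr_gt0.
  have : 0 <= (lam x - 1) * (k * y x - psi x) by rewrite mulr_ge0 //; lra.
  lra.
have b0 : 0 < b by have [] := ha b.
have ke2 : 0 < k * e / 2 by rewrite divr_gt0 ?mulr_gt0.
have Nyd x : b <= x -> is_derive x 1 (fun x => - y x) (- dy x).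
  by move=> bx; apply: is_deriveN; apply: yd; case: (ha _ bx).
have [s bs ys] : exists2 s, b <= s & y s < c.
  apply: contrapT => H.
  have yc x : b <= x -> c <= y x.
    by move=> bx; rewrite leNgt; apply/negP => yx; apply: H; exists x.
  (* Otherwise - y would grow at least like (k e / 2) log x. *)
  have [|x bx] := @ln_growth_unbounded _ (fun x => - y x) (fun x => - dy x) b
    (k * e / 2) (- c) b0 ke2 Nyd.
    by move=> x bx; rewrite mulrN lerNr step // yc.
  by rewrite ltrN2 ltNge yc.
exists s; split=> [|x /ltW sx]; first exact: num_real.
rewrite -/c -ltrN2.
apply: (@barrier _ (fun x => - y x) (fun x => - dy x) s (- c)) => //.
- by move=> z sz; apply: Nyd; apply: le_trans bs sz.
- by rewrite ltrN2.
- move=> z sz /oppr_inj yz; have bz := le_trans bs sz.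
  have [z0 _ _] := ha _ bz.
  have := step _ bz; rewrite yz lexx => /(_ isT) h.
  by rewrite -(pmulr_rgt0 _ z0) mulrN oppr_gt0 (le_lt_trans h) // oppr_lt0.
Unshelve. all: by end_near. Qed.

(** A quantity y attracted to the moving target psi / k, at a rate lam that
tends to infinity, converges to the limit of the target. *)
Lemma relax (R : realType) (y dy lam psi : R -> R) (k l : R) :
  0 < k ->
  (forall x : R, 0 < x -> is_derive x 1 y (dy x)) ->
  (forall x : R, 0 < x -> x * dy x = lam x * (psi x - k * y x)) ->
  lam x @[x --> +oo] --> +oo -> psi x @[x --> +oo] --> l ->
  y x @[x --> +oo] --> l / k.
Proof.
move=> k0 yd ydE laminf psil; apply/cvgrPdist_lt => e e0.
have up := relax_le k0 e0 yd ydE laminf psil.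
have lo : \forall x \near +oo, - y x < - l / k + e.
  apply: (@relax_le _ (fun x => - y x) (fun x => - dy x) lam (fun x => - psi x)) => //.
  - by move=> x x0; apply: is_deriveN; exact: yd.
  - by move=> x x0; rewrite mulrN ydE //; ring.
  - exact: cvgN.
near=> x; rewrite ltr_norml.
have h1 : y x < l / k + e by near: x.
have h2 : - y x < - l / k + e by near: x.
by apply/andP; lra.
Unshelve. all: by end_near. Qed.

Lemma ln_slope_ge (R : realType) (f df : R -> R) (l e : R) : 0 < e ->
  (forall x : R, 0 < x -> is_derive x 1 f (df x)) ->
  x * df x @[x --> +oo] --> l ->
  \forall x \near +oo, l - e < f x / ln x.
Proof.
move=> e0 fd dfl.
have [a [_ ha]] : \forall x \near +oo, 1 < x /\ l - e / 2 <= x * df x.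
  near=> x; split; first by near: x; apply: nbhs_pinfty_gt; rewrite num_real.
  by near: x; apply: (cvgr_ge _ dfl); rewrite gtrBl divr_gt0.
pose b := a + 1.
have {}ha x : b <= x -> 1 < x /\ l - e / 2 <= x * df x.
  by move=> bx; apply: ha => /=; apply: lt_le_trans bx; rewrite ltrDl.
have b0 : 0 < b by rewrite (lt_trans ltr01) //; case: (ha b).
pose C := (l - e / 2) * ln b - f b.
near=> x.
have bx : b <= x by near: x; apply: nbhs_pinfty_ge; rewrite num_real.
have [x1 _] := ha _ bx.
rewrite ltr_pdivlMr ?ln_gt0 //.
have : f b + (l - e / 2) * (ln x - ln b) <= f x.
  apply: (@ln_growth _ f df b _ b0 _ _ x bx) => z bz; last by case: (ha _ bz).
  by apply: fd; apply: lt_le_trans bz.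
have : C < e / 2 * ln x.
  rewrite -ltr_pdivrMl ?divr_gt0 //.
  rewrite -ltr_expR lnK; last by rewrite posrE (lt_trans ltr01 x1).
  by near: x; apply: nbhs_pinfty_gt; rewrite num_real.
rewrite /C; lra.
Unshelve. all: by end_near. Qed.

(** L'Hopital's rule for the quotient by ln at infinity: the derivative of f
with respect to log x is x f'(x). *)
Lemma ln_slope (R : realType) (f df : R -> R) (l : R) :
  (forall x : R, 0 < x -> is_derive x 1 f (df x)) ->
  x * df x @[x --> +oo] --> l ->
  f x / ln x @[x --> +oo] --> l.
Proof.
move=> fd dfl; apply/cvgrPdist_lt => e e0.
have lo := ln_slope_ge e0 fd dfl.
have up : \forall x \near +oo, - l - e < - f x / ln x.
  apply: (@ln_slope_ge _ (fun x => - f x) (fun x => - df x)) => //.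
  - by move=> x x0; apply: is_deriveN; exact: fd.
  - under eq_fun do rewrite mulrN.
    exact: cvgN.
near=> x; rewrite ltr_norml.
have h1 : l - e < f x / ln x by near: x.
have h2 : - l - e < - f x / ln x by near: x.
by rewrite mulNr in h2; apply/andP; lra.
Unshelve. all: by end_near. Qed.

(** * The planar system of w and its logarithmic slope *)

(** The derivative of g is positive on the line g = 0, where it is
2 (d - 2 q) / x, and negative on the line g = 3; the limit 2 at the origin puts
the start of the trajectory strictly between them. Any bound above 2 would
serve as well as 3. *)
Lemma slope_bounds (R : realType) (w g : R -> R) (d q k : R) :
  0 < q -> 2 * q < d -> 0 < k -> (forall x : R, 0 < x -> 0 < w x) ->
  (forall x : R, 0 < x ->
    is_derive x 1 g (((2 - g x) * (d - q * (2 - g x)) - k * w x * g x) / x)) ->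
  g x @[x --> 0^'+] --> (2 : R) ->
  forall x, 0 < x -> 0 < g x < 3.
Proof.
move=> q0 qd k0 w0 gd g2 x x0.
have [s [s0 sx [gs0 gs3]]] : exists s, [/\ 0 < s, s <= x & 0 < g s /\ g s < 3].
  have : \forall s \near 0^'+, [/\ 0 < s, s <= x & 0 < g s /\ g s < 3].
    near=> s; split.
    - by near: s; exact: nbhs_right_gt.
    - by near: s; exact: nbhs_right_le.
    - split; near: s.
        by apply: (cvgr_gt _ g2); rewrite ltr0n.
      by apply: (cvgr_lt _ g2); rewrite ltr_nat.
  by move=> /filter_ex.
have pos z : s <= z -> 0 < z by exact: lt_le_trans s0.
apply/andP; split.
  apply: (barrier (fun z sz => gd z (pos _ sz)) gs0 _ sx) => z /pos z0 ->.
  by rewrite divr_gt0 //; nra.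
rewrite -ltrN2.
apply: (@barrier _ (fun z => - g z) _ s _ _ _ _ _ sx).
- by move=> z /pos z0; apply: is_deriveN; exact: gd.
- by rewrite ltrN2.
- move=> z /pos z0 /oppr_inj gz; rewrite gz oppr_gt0 pmulr_llt0 ?invr_gt0 //.
  have := mulr_gt0 k0 (w0 _ z0); lra.
Unshelve. all: by end_near. Qed.

(** Asymptotics of the autonomous system satisfied by w = r^2 phi^(1-m) and its
logarithmic slope g. *)
Lemma slope_limit (R : realType) (w g : R -> R) (d q k : R) :
  0 < q -> 2 * q < d -> 0 < k -> (forall x : R, 0 < x -> 0 < w x) ->
  (forall x : R, 0 < x -> is_derive x 1 w (w x * g x / x)) ->
  (forall x : R, 0 < x ->
    is_derive x 1 g (((2 - g x) * (d - q * (2 - g x)) - k * w x * g x) / x)) ->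
  g x @[x --> 0^'+] --> (2 : R) ->
  w x / ln x @[x --> +oo] --> 2 * (d - 2 * q) / k.
Proof.
move=> q0 qd k0 w0 wd gd g2.
have gb := slope_bounds q0 qd k0 w0 gd g2.
have mulVK x u : 0 < x -> x * (u / x) = u :> R.
  by move=> x0; rewrite mulrC divfK ?gt_eqF.
have winc a x : 0 < a -> a <= x -> w a <= w x.
  move=> a0 ax.
  have pos z : a <= z -> 0 < z by exact: lt_le_trans a0.
  have := @ln_growth _ w _ a 0 a0 (fun z az => wd z (pos _ az)) _ x ax.
  rewrite mul0r addr0; apply=> z /pos z0; rewrite mulVK //.
  by have /andP[g0 _] := gb _ z0; rewrite mulr_ge0 ?ltW // w0.
have wunb M : exists2 x, 0 < x & M < w x.
  apply: contrapT => H.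
  have wM x : 0 < x -> w x <= M.
    by move=> x0; rewrite leNgt; apply/negP => Mw; apply: H; exists x.
  have M0 : 0 < M by apply: lt_le_trans (wM 1 ltr01); exact: w0.
  have pos z : 1 <= z -> 0 < z :> R by exact: lt_le_trans.
  pose S := d + k * M + 1.
  (* On the line g = c the derivative of g is at least
     (2 (d - 2 q) - c S) / x, which is positive when c S <= d - 2 q. *)
  pose c := Num.min (Num.min 1 (g 1 / 2)) ((d - 2 * q) / S).
  have kM := mulr_gt0 k0 M0.
  have S0 : 0 < S by rewrite /S; lra.
  have g10 : 0 < g 1 by have /andP[] := gb 1 ltr01.
  have c0 : 0 < c by rewrite !lt_min ltr01 !divr_gt0 // subr_gt0.
  have c1 : c <= 1 by rewrite !ge_min lexx.
  have cg : c < g 1.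
    have : c <= g 1 / 2 by rewrite !ge_min lexx orbT.
    lra.
  have cS : c * S <= d - 2 * q by rewrite -ler_pdivlMr // ge_min lexx orbT.
  have gc : forall x, 1 <= x -> c < g x.
    apply: (barrier (fun z sz => gd z (pos _ sz)) cg) => z /pos z0 ->.
    rewrite divr_gt0 //.
    have : k * w z * c <= k * M * c by rewrite !ler_pM2r ?ler_pM2l // wM.
    rewrite /S in cS; nra.
  have [||x x1] := @ln_growth_unbounded _ w _ 1 (w 1 * c) M ltr01 _
    (fun z sz => wd z (pos _ sz)).
  - by rewrite mulr_gt0 // w0.
  - move=> x x1; rewrite mulVK ?pos //.
    by apply: ler_pM; [exact/ltW/w0 | exact: ltW | exact: winc | exact/ltW/gc].
  by rewrite ltNge wM // pos.
have winf : w x @[x --> +oo] --> +oo.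
  apply/cvgryPge => A; have [a a0 Aa] := wunb A.
  by near=> x; apply: (le_trans (ltW Aa)); apply: winc.
pose P x := (2 - g x) * (d - q * (2 - g x)).
have Vw0 : (w x)^-1 @[x --> +oo] --> 0.
  by apply/gtr0_cvgV0 => //; near=> x; apply: w0; near: x;
     apply: nbhs_pinfty_gt; rewrite num_real.
pose C := 2 * (d + 2 * q).
have psi0 : P x / w x @[x --> +oo] --> 0.
  apply: (@squeeze_cvgr _ _ _ _ (fun x => - C * (w x)^-1)
    (fun x => C * (w x)^-1)).
  - near=> x.
    have x0 : 0 < x by near: x; apply: nbhs_pinfty_gt; rewrite num_real.
    have /andP[g0 g3] := gb _ x0.
    have iw : 0 < (w x)^-1 by rewrite invr_gt0 w0.
    rewrite !ler_pM2r // /P /C.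
    (* With 0 < g < 3 the products below bound (2 - g) (d - q (2 - g)). *)
    have ? : 0 <= q * g x by rewrite ltW // mulr_gt0.
    have ? : 0 <= q * (3 - g x) by rewrite ltW // mulr_gt0 // subr_gt0.
    have ? : 0 <= (d - 2 * q) * g x by rewrite ltW // mulr_gt0 // subr_gt0.
    have ? : 0 <= (3 - g x) * (d - 2 * q) by rewrite ltW // mulr_gt0 // subr_gt0.
    have ? : 0 <= (q * g x) * (3 - g x) by rewrite mulr_ge0 // subr_ge0 ltW.
    have ? : 0 <= q * (2 - g x) ^+ 2 by rewrite mulr_ge0 ?sqr_ge0 // ltW.
    by apply/andP; split; lra.
  - by rewrite -[X in _ --> X](mulr0 (- C)); apply: cvgMl_tmp.
  - by rewrite -[X in _ --> X](mulr0 C); apply: cvgMl_tmp.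
have g0 : g x @[x --> +oo] --> 0.
  (* D g = w (P / w - k g), and P is bounded. *)
  rewrite -(mul0r k^-1); apply: (relax k0 gd _ winf psi0) => x x0.
  by rewrite mulVK // /P; field; rewrite gt_eqF // w0.
have wgd (x : R) : 0 < x -> is_derive x 1 (fun x => w x * g x)
    (w x * (P x + g x ^+ 2 - k * (w x * g x)) / x).
  move=> x0; have := wd _ x0; have := gd _ x0 => ? ?.
  by apply: is_derive_eq; rewrite /P /GRing.scale /=; ring.
apply: (ln_slope wd).
apply: (@cvg_trans _ ((w x * g x) @[x --> +oo])).
  by apply: near_eq_cvg; near=> x; rewrite mulVK.
apply: (relax k0 wgd _ winf (psi := fun x => P x + g x ^+ 2)) => [x x0|].
  by rewrite mulVK.
have g20 : 2 - g x @[x --> +oo] --> (2 - 0 : R) by apply: cvgB => //; exact: cvg_cst.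
have -> : 2 * (d - 2 * q) = (2 - 0) * (d - q * (2 - 0)) + 0 * 0 :> R by ring.
apply: cvgD; last exact: cvgM.
by apply: cvgM => //; apply: cvgB; [exact: cvg_cst | exact: cvgMl_tmp].
Unshelve. all: by end_near. Qed.

(** * Radial functions on Euclidean space *)

(** Directional derivatives are ordinary derivatives along lines; this turns
iterated partial derivatives into one-variable calculus. *)
Lemma is_derive_line (R : realType) (n : nat) (f : 'rV[R]_n -> R)
    (x v : 'rV[R]_n) (t df : R) :
  is_derive (t *: v + x) v f df <-> is_derive t 1 (fun s => f (s *: v + x)) df.
Proof.
have E : (fun h : R => h^-1 *: ((f \o shift (t *: v + x)) (h *: v) - f (t *: v + x)))
   = (fun h : R => h^-1 *: (((fun s => f (s *: v + x)) \o shift t) (h *: 1)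
       - f (t *: v + x))).
  by apply/funext => h /=; rewrite addrA -scalerDl [h *: 1]mulr1.
by split=> -[h1 h2]; split; move: h1 h2; rewrite /derivable /derive E.
Qed.

Lemma enorm_axis (R : realType) (p : nat) (r : R) :
  enorm (r *: delta_mx 0 ord0 : 'rV[R]_p.+1) = `|r|.
Proof.
rewrite /enorm (bigD1 ord0) //= big1 ?addr0.
  by rewrite !mxE !eqxx mulr1 sqrtr_sqr.
by move=> i /negbTE i0; rewrite !mxE i0 andbF mulr0 expr0n.
Qed.

Lemma enorm_plane (R : realType) (p : nat) (i : 'I_p.+1) (r t : R) : i != ord0 ->
  enorm (t *: delta_mx 0 i + r *: delta_mx 0 ord0 : 'rV[R]_p.+1)
  = Num.sqrt (t ^+ 2 + r ^+ 2).
Proof.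
move=> i0; rewrite /enorm (bigD1 ord0) //= (bigD1 i) //= big1 ?addr0.
  rewrite !mxE !eqxx (eq_sym _ i) (negbTE i0) /=.
  by rewrite !mulr1 !mulr0 addr0 add0r addrC.
move=> j /andP[/negbTE j0 /negbTE ji].
by rewrite !mxE j0 ji !andbF !mulr0 addr0 expr0n.
Qed.

Lemma enorm_ge0 (R : realType) (n : nat) (x : 'rV[R]_n) : 0 <= enorm x.
Proof. exact: sqrtr_ge0. Qed.

Lemma radial_enorm (R : realType) (p : nat) (f : 'rV[R]_p.+1 -> R)
    (x : 'rV[R]_p.+1) : radially_symmetric f ->
  f x = f (enorm x *: delta_mx 0 ord0).
Proof. by apply; rewrite enorm_axis ger0_norm // enorm_ge0. Qed.

(** Along e_0 one differentiates F twice. In a direction e_i orthogonal to e_0,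
with rho(t) = sqrt(t^2 + r^2), the first partial derivative at t e_i + r e_0 is
F'(rho(t)) t / rho(t), and since rho'(0) = 0 its derivative at t = 0 is
F'(r) / r. *)
Lemma laplacian_radial (R : realType) (p : nat) (f : 'rV[R]_p.+1 -> R)
    (F F1 : R -> R) (F2 r : R) : radially_symmetric f ->
  (forall s, f (s *: delta_mx 0 ord0) = F s) -> 0 < r ->
  (forall s : R, 0 < s -> is_derive s 1 F (F1 s)) -> is_derive r 1 F1 F2 ->
  laplacian f (r *: delta_mx 0 ord0) = F2 + p%:R * (F1 r / r).
Proof.
move=> frad fF r0 Fd F1d.
rewrite /laplacian (bigD1 ord0) //=; congr (_ + _).
  have parE (s : R) : 0 < s -> partial ord0 f (s *: delta_mx 0 ord0) = F1 s.
    move=> s0; apply: derive_val; rewrite -[X in is_derive X]addr0.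
    apply/is_derive_line; have -> : (fun s => f (s *: delta_mx 0 ord0 + 0)) = F.
      by apply/funext => u; rewrite addr0 fF.
    exact: Fd.
  apply: derive_val; rewrite -[X in is_derive X]addr0; apply/is_derive_line.
  apply: near_eq_is_derive F1d; near=> s; rewrite addr0 parE //.
  by near: s; exact: lt_nbhsr.
rewrite (eq_bigr (fun=> F1 r / r)).
  rewrite sumr_const mulr_natl; congr (_ *+ _).
  by rewrite cardC1 card_ord.
move=> i i0; pose rho := fun t : R => Num.sqrt (t ^+ 2 + r ^+ 2).
have arg0 t : 0 < t ^+ 2 + r ^+ 2 by rewrite ltr_wpDl ?sqr_ge0 // exprn_gt0.
have rho0 t : 0 < rho t by rewrite sqrtr_gt0.
have rhod (t : R) : is_derive t 1 rho (t / rho t).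
  have d1 : is_derive t 1 (fun t : R => t ^+ 2 + r ^+ 2) (2 * t).
    by apply: is_derive_eq; rewrite /GRing.scale /=; ring.
  have d2 := is_derive1_sqrt (arg0 t).
  have := @is_derive1_comp _ _ (fun t : R => t ^+ 2 + r ^+ 2) _ _ _ d2 d1.
  rewrite -/(rho t) => d3.
  by apply: (is_derive_eq d3); field; rewrite gt_eqF.
have fE t : f (t *: delta_mx 0 i + r *: delta_mx 0 ord0) = F (rho t).
  rewrite -fF; apply: frad; rewrite enorm_plane // enorm_axis.
  by rewrite ger0_norm // ltW.
have parE t : partial i f (t *: delta_mx 0 i + r *: delta_mx 0 ord0)
    = F1 (rho t) * (t / rho t).
  apply: derive_val; apply/is_derive_line.
  have -> : (fun s => f (s *: delta_mx 0 i + r *: delta_mx 0 ord0)) = F \o rho.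
    by apply/funext => u; rewrite fE.
  by apply: is_derive1_comp; exact: Fd.
have rr : rho 0 = r by rewrite /rho expr0n add0r sqrtr_sqr gtr0_norm.
apply: derive_val; rewrite -[X in is_derive X]add0r -(scale0r (delta_mx 0 i)).
apply/is_derive_line.
have -> : (fun s => partial i f (s *: delta_mx 0 i + r *: delta_mx 0 ord0))
    = (fun t => (F1 \o rho) t * (t * (rho t)^-1)).
  by apply/funext => u; rewrite parE.
have c1 : is_derive (0 : R) 1 (F1 \o rho) (F2 * (0 / rho 0)).
  by apply: is_derive1_comp => //; rewrite rr.
have c2 := is_deriveV (lt0r_neq0 (rho0 0)) (rhod 0).
by apply: is_derive_eq; rewrite /GRing.scale /= rr; ring.
Unshelve. all: by end_near. Qed.

Lemma enorm_cvgy (R : realType) (n : nat) :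
  enorm x @[x --> enorm_pinfty R n] --> +oo.
Proof.
by apply/cvgryPgt => A; exists A.
Qed.

(** * The radial equation *)

Lemma is_derive_powR_comp (R : realType) (f : R -> R) (a x df : R) :
  0 < f x -> is_derive x 1 f df ->
  is_derive x 1 (fun y => f y `^ a) (a * f x `^ (a - 1) * df).
Proof. by move=> f0 fd; exact: is_derive1_comp (is_derive1_powR _ f0) fd. Qed.

(** The profile phi and its derivatives are the restrictions of v, of its first
and of its second partial derivative along e_0 to the line through e_0. This
line passes through the origin, so phi is differentiable on the whole real line;
this is what later controls the solution as r -> 0. *)
Lemma radial_ode (R : realType) (p : nat) (m alpha beta : R)
    (v : 'rV[R]_p.+1 -> R) :
  classical_positive_solution m alpha beta v -> radially_symmetric v -> m != 0 ->
  exists phi phi1 phi2 : R -> R, [/\ forall x, v x = phi (enorm x),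
    forall r, 0 < phi r,
    forall r : R, is_derive r 1 phi (phi1 r),
    forall r : R, is_derive r 1 phi1 (phi2 r) &
    forall r, 0 < r ->
      p%:R * (phi r `^ (m - 1) * phi2 r
        + (m - 1) * phi r `^ (m - 2) * phi1 r ^+ 2
        + p%:R * phi r `^ (m - 1) * phi1 r / r)
      + alpha * phi r + beta * (r * phi1 r) = 0].
Proof.
move=> [[C1 C2] v0 eqv] vrad m0.
pose e0 : 'rV[R]_p.+1 := delta_mx 0 ord0.
pose phi r := v (r *: e0); pose phi1 r := partial ord0 v (r *: e0).
pose phi2 r := partial ord0 (partial ord0 v) (r *: e0).
have along f (r : R) : derivable f (r *: e0) e0 ->
    is_derive r 1 (fun s => f (s *: e0)) (partial ord0 f (r *: e0)).
  move=> /derivableP; rewrite -[X in is_derive X]addr0 => /is_derive_line.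
  by under eq_fun do rewrite addr0.
have phid (r : R) : is_derive r 1 phi (phi1 r) by apply: along; case: (C1 ord0).
have phi1d (r : R) : is_derive r 1 phi1 (phi2 r).
  by apply: along; case: (C2 ord0 ord0).
exists phi, phi1, phi2; split => //; first by move=> x; exact: radial_enorm.
  by move=> r; exact: v0.
move=> r r0; have ph0 s : 0 < phi s by exact: v0.
have radm : radially_symmetric (fun y => v y `^ m).
  by move=> x y xy; rewrite (vrad x y xy).
have Ud (s : R) : is_derive s 1 (fun s => phi s `^ m) (m * phi s `^ (m - 1) * phi1 s).
  exact: is_derive_powR_comp.
have U1d : is_derive r 1 (fun s => m * phi s `^ (m - 1) * phi1 s)
    (m * ((m - 1) * phi r `^ (m - 2) * phi1 r * phi1 r + phi r `^ (m - 1) * phi2 r)).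
  have := @is_derive_powR_comp _ phi (m - 1) _ _ (ph0 r) (phid r).
  rewrite (_ : m - 1 - 1 = m - 2); last by ring.
  move=> dp; have d2 := phi1d r.
  by apply: is_derive_eq; rewrite /GRing.scale /=; ring.
have L := laplacian_radial radm (fun s => erefl) r0 (fun s _ => Ud s) U1d.
have dg : dot_grad (r *: e0) v = r * phi1 r.
  rewrite /dot_grad (bigD1 ord0) //= big1 ?addr0.
    by rewrite !mxE !eqxx mulr1.
  by move=> i /negbTE i0; rewrite !mxE i0 andbF mulr0 mul0r.
have := eqv (r *: e0); rewrite L dg -/(phi r) => <-.
rewrite -[p.+1]addn1 natrD addrK; congr (_ + _ + _).
by field; rewrite m0 gt_eqF.
Qed.

(** After division by a power of phi the radial equation gives r^2 phi'' / phi
as a polynomial in X = r phi' / phi and w, and alpha + beta X = beta g / (1 - m).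
Substituting X = (g - 2) / (1 - m) in the derivative of g leaves w and g as the
only unknowns. *)
Lemma phase_system (R : realType) (p : nat) (m alpha beta : R)
    (phi phi1 phi2 : R -> R) (r : R) :
  (0 < p)%N -> m < 1 -> alpha = 2 * beta / (1 - m) -> 0 < r ->
  0 < phi r ->
  is_derive r 1 phi (phi1 r) -> is_derive r 1 phi1 (phi2 r) ->
  p%:R * (phi r `^ (m - 1) * phi2 r + (m - 1) * phi r `^ (m - 2) * phi1 r ^+ 2
    + p%:R * phi r `^ (m - 1) * phi1 r / r)
    + alpha * phi r + beta * (r * phi1 r) = 0 ->
  let w s := s ^+ 2 * phi s `^ (1 - m) in
  let g s := 2 + (1 - m) * (s * phi1 s / phi s) in
  is_derive r 1 w (w r * g r / r) /\
  is_derive r 1 g (((2 - g r) * (p%:R - 1 - m / (1 - m) * (2 - g r))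
     - beta / p%:R * w r * g r) / r).
Proof.
move=> p0 m1 -> r0 ph0 d1 d2 ode w g.
have phN0 : phi r != 0 by rewrite gt_eqF.
have rN0 : r != 0 by rewrite gt_eqF.
have mN0 : 1 - m != 0 by rewrite gt_eqF // subr_gt0.
have pN0 : p%:R != 0 :> R by rewrite pnatr_eq0 -lt0n.
pose P := phi r `^ (1 - m); have P0 : P != 0 by rewrite gt_eqF // powR_gt0.
have E1 : phi r `^ (m - 1) = P^-1 by rewrite /P -powRN opprB.
have E2 : phi r `^ (m - 2) = P^-1 / phi r.
  rewrite -E1 (_ : m - 2 = m - 1 - 1); last by ring.
  by rewrite powRB ?phN0 ?implybT // powRr1 // ltW.
split.
  have := @is_derive_powR_comp _ phi (1 - m) _ _ ph0 d1.
  rewrite powRB ?phN0 ?implybT // powRr1 ?ltW // -/P => d3.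
  by apply: is_derive_eq; rewrite /w /g -/P /GRing.scale /=; field; rewrite rN0 phN0.
have d4 := is_deriveV phN0 d1.
have -> : g = (fun s => 2 + (1 - m) * (s * phi1 s * (phi s)^-1)) by [].
apply: is_derive_eq; rewrite /w -/P /GRing.scale /=.
have -> : phi2 r = - ((m - 1) / phi r * phi1 r ^+ 2 + p%:R * phi1 r / r
    + P / p%:R * (2 * beta / (1 - m) * phi r + beta * (r * phi1 r))).
  move: ode; rewrite E1 E2 => ode.
  apply/eqP; rewrite -subr_eq0; apply/eqP.
  rewrite -[RHS](mulr0 (P / p%:R)) -[in RHS]ode.
  by field; rewrite phN0 rN0 mN0 pN0 P0.
by field; rewrite phN0 rN0 mN0 pN0.
Qed.

(** * The asymptotic behaviour *)

Unset Implicit Arguments.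
Set Strict Implicit.

Theorem theorem2p3 (R : realType) (n : nat) (m eta alpha beta : R)
    (v : 'rV[R]_n -> R)
    (hn : (3 <= n)%N)
    (hm0 : 0 < m) (hm : m < (n%:R - 2) / n%:R)
    (heta : 0 < eta)
    (halpha : alpha = 2 * beta / (1 - m)) (halpha0 : 0 < alpha)
    (hv : classical_positive_solution m alpha beta v)
    (hrad : radially_symmetric v)
    (hv0 : v 0 = eta) :
  (enorm x ^+ 2 * v x `^ (1 - m)) / ln (enorm x) @[x --> enorm_pinfty R n]
    --> 2 * (n%:R - 1) * (n%:R - 2 - n%:R * m) / (beta * (1 - m)).
Proof.
case: n v hn hm hv hrad hv0 => [//|p] v hn hm hv hrad hv0.
have p0 : (0 < p)%N by rewrite -ltnS ltnW.
have pR : 2 <= p%:R :> R by rewrite ler_nat.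
have nE : p.+1%:R = p%:R + 1 :> R by rewrite -addn1 natrD.
have hmn : m * (p%:R + 1) < p%:R - 1.
  by move: hm; rewrite ltr_pdivlMr ?ltr0n // nE; lra.
have m1 : m < 1 by nra.
have m1' : 0 < 1 - m by lra.
have b0 : 0 < beta.
  by move: halpha0; rewrite halpha pmulr_lgt0 ?invr_gt0 // pmulr_rgt0.
have [phi [phi1 [phi2 [vE ph0 d1 d2 ode]]]] := radial_ode hv hrad (lt0r_neq0 hm0).
pose w s := s ^+ 2 * phi s `^ (1 - m).
pose g s := 2 + (1 - m) * (s * phi1 s / phi s).
have sys (r : R) (r0 : 0 < r) :=
  phase_system p0 m1 halpha r0 (ph0 r) (d1 r) (d2 r) (ode r r0).
have g2 : g x @[x --> 0^'+] --> (2 : R).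
  apply: cvg_at_right_filter.
  have c1 := is_derive_continuous (d1 0); have c2 := is_derive_continuous (d2 0).
  have -> : (2 : R) = 2 + (1 - m) * (0 * phi1 0 / phi 0) by rewrite !mul0r mulr0 addr0.
  apply: cvgD; first exact: cvg_cst.
  apply: cvgMl_tmp; apply: cvgM; first by apply: cvgM.
  by apply: cvgV => //; rewrite gt_eqF.
have W : w x / ln x @[x --> +oo]
    --> 2 * (p%:R - 1 - 2 * (m / (1 - m))) / (beta / p%:R).
  apply: (@slope_limit _ w g) => //.
  - by rewrite divr_gt0.
  - by rewrite mulrA ltr_pdivrMr //; lra.
  - by rewrite divr_gt0 // ltr0n.
  - by move=> x x0; rewrite mulr_gt0 ?exprn_gt0 // powR_gt0.
  - by move=> x /sys[].
  - by move=> x /sys[].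
have -> : 2 * (p.+1%:R - 1) * (p.+1%:R - 2 - p.+1%:R * m) / (beta * (1 - m))
    = 2 * (p%:R - 1 - 2 * (m / (1 - m))) / (beta / p%:R).
  by rewrite nE; field; rewrite !gt_eqF // ltr0n.
under eq_fun do rewrite vE.
exact: (cvg_comp _ _ (@enorm_cvgy R p.+1) W).
Qed.
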